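(* Let $m$ be a positive integer and $u\in[m]^*$. Then \[\{P(w): w\in C(\mathrm{RC}_m(u))\}=\{\tau_m(P(w)): w\in C(u)\}.\]
   Context: Words are finite strings of positive integers; $[m]^*$ is the set of words with letters in $\{1,\dots,m\}$. $P(w)$ is the RSK insertion tableau of $w$. Knuth equivalence $\equiv$ is generated by $xacby\equiv xcaby$ for $a\le b<c$ and $xbacy\equiv xbcay$ for $a<b\le c$; $v\equiv w$ iff $P(v)=P(w)$. The plactic centralizer is $C(u)=\{w: uw\equiv wu\}$ (over all words $w$, with arbitrary positive-integer letters). For $w=w_1\cdots w_n\in[m]^*$, $\mathrm{RC}_m(w)=(m+1-w_n)\cdots(m+1-w_1)$. For a semistandard tableau $T$, $\mathrm{rw}(T)$ is its row word (read left to right along each row, bottom row first, moving upward). For $T$ with entries in $[m]$, $\epsilon_m(T)=P(\mathrm{RC}_m(\mathrm{rw}(T)))$, which has the same shape as $T$. For an arbitrary semistandard tableau $T$, let $T_{\le m}$ be the subtableau of entries at most $m$ and $T_{>m}$ the complementary skew tableau; $\tau_m(T)$ is obtained from $T$ by replacing $T_{\le m}$ with $\epsilon_m(T_{\le m})$ and leaving $T_{>m}$ unchanged. *)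

(* Defs.v *)
From mathcomp Require Import all_boot.
From mathcomp Require Import classical_sets.
From Stdlib Require Import Relations.

Set Implicit Arguments.
Unset Strict Implicit.
Unset Printing Implicit Defensive.

Local Open Scope nat_scope.

(* Words are represented by sequences of natural numbers; positivity of the
   letters is imposed by [is_word] (letters unbounded above) or [word_le m]
   (letters in {1, ..., m}). *)
Definition is_word (w : seq nat) : bool := all (fun x => 0 < x) w.

Definition word_le (m : nat) (w : seq nat) : bool :=
  all (fun x => 0 < x <= m) w.

Inductive knuth_step : seq nat -> seq nat -> Prop :=
| Knuth_acb x y a b c : a <= b -> b < c ->
    knuth_step (x ++ [:: a; c; b] ++ y) (x ++ [:: c; a; b] ++ y)
| Knuth_bac x y a b c : a < b -> b <= c ->
    knuth_step (x ++ [:: b; a; c] ++ y) (x ++ [:: b; c; a] ++ y).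

Definition knuth_equiv : seq nat -> seq nat -> Prop :=
  clos_refl_sym_trans (seq nat) knuth_step.

Definition plactic_centralizer (u : seq nat) : set (seq nat) :=
  [set w | is_word w /\ knuth_equiv (u ++ w) (w ++ u)]%classic.

(* A tableau is the list of its rows, in English convention: the first row of
   the list is the top row, and entries increase strictly down columns. *)
Definition tableau := seq (seq nat).

(* Row insertion of x: x replaces the leftmost entry greater than x, which is
   returned, or is appended to the row if there is no such entry. *)
Fixpoint row_insert (x : nat) (r : seq nat) : seq nat * option nat :=
  if r is y :: r' then
    if x < y then (x :: r', Some y)
    else let: (s, o) := row_insert x r' in (y :: s, o)
  else ([:: x], None).

Fixpoint tab_insert (x : nat) (T : tableau) : tableau :=
  if T is r :: T' then
    match row_insert x r with
    | (s, Some y) => s :: tab_insert y T'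
    | (s, None) => s :: T'
    end
  else [:: [:: x]].

Definition rskP (w : seq nat) : tableau :=
  foldl (fun T x => tab_insert x T) [::] w.

Definition RC (m : nat) (w : seq nat) : seq nat :=
  [seq m.+1 - x | x <- rev w].

Definition row_word (T : tableau) : seq nat := flatten (rev T).

Definition epsilon (m : nat) (T : tableau) : tableau :=
  rskP (RC m (row_word T)).

(* The entries at most m fill an initial segment of each row of a semistandard
   tableau; rows that become empty are dropped. *)
Definition tab_le (m : nat) (T : tableau) : tableau :=
  [seq r <- [seq [seq x <- s | x <= m] | s <- T] | r != [::]].

(* Row i of the result is row i of [epsilon m (tab_le m T)] followed by the
   entries of row i of T greater than m. When T is semistandard,
   [epsilon m (tab_le m T)] has the shape of [tab_le m T], so the latter
   entries keep their positions. *)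
Definition tau (m : nat) (T : tableau) : tableau :=
  mkseq (fun i => nth [::] (epsilon m (tab_le m T)) i ++
                  [seq x <- nth [::] T i | m < x]) (size T).

(* Main.v *)
(* Idea.  Greene's theorem describes the row lengths of [P(w)] by the largest
   numbers of letters of [w] covered by k weakly increasing subsequences, and
   [P(w)] is determined by the shapes of [P] of the restrictions of [w] to
   letters at most [j].  Let [uw == wu] with [u] in [[m]^*].  Inserting [u] into
   [P(w)] moves letters above [m] weakly down, multiplying by [u] on the left
   moves them weakly up (a supermodularity of the Greene numbers); as the two
   results agree, these letters do not move.  So [uw == wu] iff [u] commutes
   with the restriction [y] of [w] to letters at most [m] and the boxes added to
   the shape of [y] by [u] avoid the boxes of [P(w)] with letters above [m].
   Since [RC_m] is an anti-automorphism of the plactic monoid on [[m]] that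
   preserves shapes, this criterion is invariant under [u, y -> RC u, RC y]. *)

From Stdlib Require Import Relations.
Require Import Defs.
From mathcomp Require Import all_boot.
From mathcomp Require Import classical_sets.
From mathcomp Require Import zify.

Set Implicit Arguments.
Unset Strict Implicit.
Unset Printing Implicit Defensive.

Local Open Scope nat_scope.

(** * Greene numbers *)

Definition nondec (N : nat -> nat) := forall s t, s <= t -> N s <= N t.

(* A family of weakly increasing chains is recorded by the function [N] such
   that [N t] chains have last letter at most [t]. Then [extend p N] is the
   result of appending [p] to the chain whose last letter is the largest one
   at most [p], and [chains w N] is the largest number of letters of [w] that
   can be appended to such a family. *)
Definition extend (p : nat) (N : nat -> nat) (t : nat) : nat :=
  if t < p then minn (N t) (N p).-1 else N t.

Ltac extend_lia := rewrite /extend; repeat (case: ifP => ?); lia.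

Fixpoint chains (w : seq nat) (N : nat -> nat) : nat :=
  if w is p :: w' then
    maxn (chains w' N) (if 0 < N p then (chains w' (extend p N)).+1 else 0)
  else 0.

(** The constant family stands for [k] empty chains, which any letter may extend. *)
Definition greene (k : nat) (w : seq nat) : nat := chains w (fun=> k).

Definition upto (j : nat) (w : seq nat) : seq nat := [seq x <- w | x <= j].

Lemma extend_nondec p N : nondec N -> nondec (extend p N).
Proof.
move=> hN s t le_st; have := hN _ _ le_st.
by extend_lia.
Qed.

Lemma extend_le p N t : extend p N t <= N t.
Proof. by rewrite /extend; case: ifP => _; rewrite ?geq_minl. Qed.

Lemma chains_mono w (N N' : nat -> nat) :
  (forall t, N t <= N' t) -> chains w N <= chains w N'.
Proof.
elim: w N N' => //= p w IH N N' h.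
have h1 := IH _ _ h; have h2 := h p.
have : chains w (extend p N) <= chains w (extend p N').
  by apply: IH => t; have := h t; extend_lia.
by case: ifP; case: ifP; lia.
Qed.

Lemma chains_skip p w N : chains w N <= chains (p :: w) N.
Proof. exact: leq_maxl. Qed.

Lemma chains_take p w N :
  0 < N p -> chains w (extend p N) < chains (p :: w) N.
Proof. by move=> h /=; rewrite h leq_maxr. Qed.

Lemma chains_cons p w N : chains (p :: w) N = chains w N \/
  0 < N p /\ chains (p :: w) N = (chains w (extend p N)).+1.
Proof.
move=> /=; case: ifP => h; last by rewrite maxn0; left.
by case: leqP => _; [right | left].
Qed.

Lemma chains_cons_le p w N b :
  chains w N <= b -> (0 < N p -> chains w (extend p N) < b) ->
  chains (p :: w) N <= b.
Proof. by move=> h1 h2; have [->//|[/h2 h ->]] := chains_cons p w N. Qed.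

Ltac chains_case h :=
  match goal with
  | |- is_true (leq ?X _) =>
    match X with
    | context [chains (?p :: ?w) ?N] => have [->|[h ->]] := chains_cons p w N
    end
  end.

Ltac skip_letter := apply: (leq_trans _ (chains_skip _ _ _)).

Ltac take_letter h := apply: (leq_trans _ (chains_take _ h)); rewrite ltnS.

(** * Invariance of chain counts under the Knuth relations *)

Lemma eq_chains_cat x v w :
  (forall N, nondec N -> chains v N = chains w N) ->
  forall N, nondec N -> chains (x ++ v) N = chains (x ++ w) N.
Proof.
move=> h; elim: x => //= p x IH N hN.
by rewrite !IH //; exact: extend_nondec.
Qed.

(** Whatever letters are appended in the order [c], [a] can also be appended in the order [a], [c],
    and the resulting family is pointwise at least as large. *)
Lemma chains_swap a c w N : a <= c -> nondec N ->
  chains [:: c, a & w] N <= chains [:: a, c & w] N.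
Proof.
move=> le_ac hN; have hac := hN _ _ le_ac.
chains_case hc; chains_case ha.
- by do 2 skip_letter.
- by take_letter ha; skip_letter.
- by skip_letter; exact: chains_take.
have ha' : 0 < N a by move: ha; extend_lia.
have hc' : 0 < extend a N c by extend_lia.
take_letter ha'; take_letter hc'; apply: chains_mono => t.
by have := hN t a; extend_lia.
Qed.

(* When [N a < N c], some chain ends in a letter of [a+1, c]; [c] can extend
   this chain instead of the one just extended by [a]. *)
Lemma chains_unswap a c w N : a < c -> nondec N -> N a < N c ->
  chains [:: a, c & w] N <= chains [:: c, a & w] N.
Proof.
move=> lt_ac hN lt_N; chains_case ha; chains_case hc.
- by do 2 skip_letter.
- by take_letter hc; skip_letter.
- by skip_letter; exact: chains_take.
have hc' : 0 < N c by lia.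
have ha' : 0 < extend c N a by extend_lia.
take_letter hc'; take_letter ha'; apply: chains_mono => t.
by have := hN t a; extend_lia.
Qed.

(** If [N a < N c], [chains_unswap] applies. Otherwise no chain ends in [[a+1, c]], and a selection
    of [a] and [c] without [b] may take [b] in place of [c]. *)
Lemma chains_acb a b c w N : a <= b -> b < c -> nondec N ->
  chains [:: a, c, b & w] N = chains [:: c, a, b & w] N.
Proof.
move=> le_ab lt_bc hN; have lt_ac : a < c by lia.
apply/eqP; rewrite eqn_leq; apply/andP; split; last exact: chains_swap (ltnW lt_ac) hN.
have hab := hN _ _ le_ab; have hbc := hN _ _ (ltnW lt_bc).
have [lt_N|le_N] := ltnP (N a) (N c); first exact: chains_unswap.
have le_t t : (extend c (extend a N)) t <= (extend b (extend a N)) t.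
  have := hN t a; have := hN a t; have := hN t b; have := hN t c.
  by extend_lia.
chains_case ha; chains_case hc.
- by do 2 skip_letter.
- by take_letter hc; skip_letter.
- by skip_letter; exact: chains_take.
have hb' : 0 < extend a N b by extend_lia.
chains_case hb.
  by skip_letter; take_letter ha; take_letter hb'; exact: chains_mono.
have hc' : 0 < N c by lia.
have ha' : 0 < extend c N a by move: hb; extend_lia.
have hb'' : 0 < extend a (extend c N) b by move: hb; extend_lia.
take_letter hc'; take_letter ha'; take_letter hb''.
apply: chains_mono => t; have := hN t a; have := hN a t.
by have := hN t b; have := hN t c; extend_lia.
Qed.

(** Once [b] is taken, a chain ends in [[a+1, c]] and [chains_unswap] applies. If [b] is skipped and
    no chain ends there, a selection of [a] and [c] may take [b] and [c] instead. *)
Lemma chains_bac a b c w N : a < b -> b <= c -> nondec N ->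
  chains [:: b, a, c & w] N = chains [:: b, c, a & w] N.
Proof.
move=> lt_ab le_bc hN; have lt_ac : a < c by lia.
have hab := hN _ _ (ltnW lt_ab); have hbc := hN _ _ le_bc.
apply/eqP; rewrite eqn_leq; apply/andP; split; last first.
  chains_case hb; first by skip_letter; exact: chains_swap (ltnW lt_ac) hN.
  take_letter hb; apply: chains_swap (ltnW lt_ac) _; exact: extend_nondec.
chains_case hb; last first.
  take_letter hb; apply: chains_unswap => //; first exact: extend_nondec.
  by move: hb; extend_lia.
have [lt_N|le_N] := ltnP (N a) (N c); first by skip_letter; exact: chains_unswap.
chains_case ha; chains_case hc.
- by do 3 skip_letter.
- by skip_letter; take_letter hc; skip_letter.
- by do 2 skip_letter; exact: chains_take.
have hb : 0 < N b by lia.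
have hc' : 0 < extend b N c by extend_lia.
take_letter hb; take_letter hc'; skip_letter.
apply: chains_mono => t; have := hN t a; have := hN a t.
by have := hN t b; have := hN t c; extend_lia.
Qed.

Lemma knuth_step_chains j v w N : knuth_step v w -> nondec N ->
  chains (upto j v) N = chains (upto j w) N.
Proof.
rewrite /upto; case=> {v w} x y a b c h1 h2 hN; rewrite !filter_cat.
  apply: eq_chains_cat => // {hN}N hN /=; case: (leqP c j) => hc //.
  have -> : a <= j by lia.
  have -> : b <= j by lia.
  exact: chains_acb.
apply: eq_chains_cat => // {hN}N hN /=; case: (leqP c j) => hc //.
have -> : a <= j by lia.
have -> : b <= j by lia.
exact: chains_bac.
Qed.

Lemma knuth_greene j k v w :
  knuth_equiv v w -> greene k (upto j v) = greene k (upto j w).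
Proof.
elim=> {v w} [v w h|//|//|u v w _ -> _ -> //].
exact: knuth_step_chains.
Qed.

(** * Greene numbers of a tableau *)

Fixpoint above (r s : seq nat) {struct s} : bool :=
  match s, r with
  | [::], _ => true
  | y :: s', x :: r' => (x < y) && above r' s'
  | _ :: _, [::] => false
  end.

(** Empty rows are allowed, so that the property survives restricting the letters and deleting the
    first column; [tableau_rows] excludes them. *)
Definition semistandard (T : tableau) : bool :=
  all (sorted leq) T && sorted above T.

Lemma aboveP r s :
  reflect (size s <= size r /\
           forall i, i < size s -> nth 0 r i < nth 0 s i) (above r s).
Proof.
elim: s r => [|y s IH] [|x r] /=; try by constructor.
  by constructor=> -[].
apply: (iffP andP) => [[lt_xy /IH [hs h]]|[hs h]]; first by split=> // -[|i] //= /h.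
by split; [exact: (h 0)|apply/IH; split=> // i; exact: (h i.+1)].
Qed.

Lemma above_trans : transitive above.
Proof.
move=> s r t /aboveP [h1 h2] /aboveP [h3 h4]; apply/aboveP; split; first lia.
by move=> i hi; apply: ltn_trans (h2 _ _) (h4 _ hi); lia.
Qed.

Lemma above_upto j r s : sorted leq s -> above r s -> above (upto j r) (upto j s).
Proof.
rewrite /upto; elim: s r => [|y s IH] [|x r] //= hs /andP [lt_xy h].
case: (leqP y j) => hy.
  have -> /= : x <= j by lia.
  by rewrite lt_xy IH // (path_sorted hs).
have -> : [seq z <- s | z <= j] = [::]; last by case: ifP.
apply/eqP; rewrite -[_ == _]negbK -has_filter; apply/hasPn => z hz.
by have /allP /(_ _ hz) := order_path_min leq_trans hs; rewrite -ltnNge; lia.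
Qed.

Lemma semistandard_upto j T :
  semistandard T -> semistandard [seq upto j r | r <- T].
Proof.
case/andP=> hr hc; apply/andP; split.
  rewrite all_map; apply: sub_all hr => r /=.
  exact: sorted_filter leq_trans _ _.
elim: T hr hc => //= r [|s T] IH //= /and3P [_ hs hr] /andP [h1 h2].
by rewrite above_upto //=; apply: IH => //=; rewrite hs.
Qed.

Lemma row_word_cons r T : row_word (r :: T) = row_word T ++ r.
Proof. by rewrite /row_word rev_cons flatten_rcons. Qed.

Lemma upto_row_word j T : upto j (row_word T) = row_word [seq upto j r | r <- T].
Proof.
by elim: T => //= r T IH; rewrite !row_word_cons -IH /upto filter_cat.
Qed.

(** * Peeling off the first column *)

Inductive shuffle : seq nat -> seq nat -> seq nat -> Prop :=
| Shuffle_nil : shuffle [::] [::] [::]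
| Shuffle_l x d v w : shuffle d v w -> shuffle (x :: d) v (x :: w)
| Shuffle_r x d v w : shuffle d v w -> shuffle d (x :: v) (x :: w).

Lemma shuffle_cat d v w d' v' w' : shuffle d v w -> shuffle d' v' w' ->
  shuffle (d ++ d') (v ++ v') (w ++ w').
Proof. by move=> h h'; elim: h => //= *; constructor. Qed.

Lemma shuffle0 w : shuffle [::] w w.
Proof. by elim: w => *; constructor. Qed.

Lemma chains_shuffle_size d v w N : shuffle d v w ->
  chains w N <= size d + chains v N.
Proof.
move=> h; elim: h N => //= {d v w} p d v w _ IH N.
  apply: chains_cons_le; first by have := IH N; lia.
  move=> _; have := IH (extend p N).
  by have := chains_mono v (extend_le p N); lia.
apply: chains_cons_le; first by have := IH N; lia.
by move=> h; have := IH (extend p N); rewrite h; lia.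
Qed.

(** A weakly increasing chain meets the strictly decreasing [d] at most once: after [p] is taken,
    the count at every later, smaller letter of [d] is below [N p]. *)
Lemma chains_shuffle_decreasing d v w N b : shuffle d v w ->
  pairwise gtn d -> {in d, forall t, N t <= b} -> chains w N <= b + chains v N.
Proof.
move=> h; elim: h N b => [N b _ _|p d' v' w' _ IH N b /= /andP [hp hd] hb|
    p d' v' w' _ IH N b hd hb] //.
  apply: chains_cons_le => [|h].
    by apply: IH => // t ht; apply: hb; rewrite inE ht orbT.
  have hpb : N p <= b by apply: hb; rewrite inE eqxx.
  have := IH (extend p N) b.-1 hd.
  have := chains_mono v' (extend_le p N).
  suff : {in d', forall t, extend p N t <= b.-1} by move=> h1 h2 /(_ h1); lia.
  by move=> t /(allP hp) /= lt_tp; rewrite /extend lt_tp; lia.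
apply: chains_cons_le => [|h].
  by apply: leq_trans (IH _ _ hd hb) _; rewrite leq_add2l chains_skip.
have := chains_take v' h.
have : chains w' (extend p N) <= b + chains v' (extend p N); last by lia.
by apply: IH => // t ht; apply: leq_trans (extend_le _ _ _) (hb _ ht).
Qed.

Lemma shuffle_first_column T :
  shuffle (row_word [seq take 1 r | r <- T]) (row_word [seq behead r | r <- T])
          (row_word T).
Proof.
elim: T => [|r T IH] /=; first by constructor.
rewrite !row_word_cons; apply: shuffle_cat => //.
case: r => [|x r] /=; first by constructor.
by rewrite take0; constructor; exact: shuffle0.
Qed.

Lemma first_column_decreasing T :
  sorted above T -> pairwise gtn (row_word [seq take 1 r | r <- T]).
Proof.
rewrite sorted_pairwise; last exact: above_trans.
elim: T => //= r T IH /andP [hr hT].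
rewrite row_word_cons pairwise_cat IH //=; apply/andP; split; last first.
  by case: r {hr} => //= x r; rewrite take0.
case: r hr => [|x r] hr /=; first exact: allrel0r.
rewrite take0 allrel1r; apply/allP => z /flattenP [s].
rewrite mem_rev => /mapP [t ht ->{s}].
by have := allP hr _ ht; case: t {ht} => //= y t; rewrite take0 inE => /andP [h _] /eqP ->.
Qed.

Lemma first_column_size k T : sorted above T ->
  minn k (size (row_word [seq take 1 r | r <- T])) <=
  \sum_(0 <= i < k) size (nth [::] [seq take 1 r | r <- T] i).
Proof.
elim: T k => [|r T IH] k /= hT; first by rewrite /row_word /= minn0.
case: k => [|k]; first by rewrite min0n.
rewrite row_word_cons size_cat big_nat_recl //=.
have := IH k (path_sorted hT); case: r hT => [|x r] hT /=; last first.
  by rewrite take0 /=; lia.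
(* Below an empty row all rows are empty, as [above] makes row lengths weakly decrease. *)
suff -> : row_word [seq take 1 r | r <- T] = [::] by rewrite /= minn0.
move: hT; rewrite (path_sortedE above_trans) => /andP [hT _].
elim: T hT {IH} => //= s T IH /andP [hs hT].
by rewrite row_word_cons IH //; case: s hs.
Qed.

Lemma semistandard_behead T :
  semistandard T -> semistandard [seq behead r | r <- T].
Proof.
case/andP=> hr hc; apply/andP; split.
  by rewrite all_map; apply: sub_all hr => -[|x r] //= /path_sorted.
elim: T hc {hr} => //= r [|s T] IH //= /andP [h1 h2]; have /= -> := IH h2; rewrite andbT.
by case: r s h1 {IH h2} => [|x r] [|y s] //= /andP [].
Qed.

(** Induction on the number of columns: the first column, strictly decreasing in the row word,
    contributes at most the minimum of [k] and its length. *)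
Lemma greene_row_word_le k T : semistandard T ->
  greene k (row_word T) <= \sum_(0 <= i < k) size (nth [::] T i).
Proof.
have [n] : exists n, all (fun r => size r <= n) T.
  exists (\max_(r <- T) size r); apply/allP => r hr.
  by rewrite (big_rem r) //= leq_maxl.
elim: n T => [|n IH] T hn hT.
  suff -> : row_word T = [::] by [].
  by elim: T hn {hT} => //= r T IH /andP [hr /IH]; rewrite row_word_cons => ->; case: r hr.
have hb : all (fun r => size r <= n) [seq behead r | r <- T].
  by rewrite all_map; apply: sub_all hn => r /=; rewrite size_behead; lia.
have := IH _ hb (semistandard_behead hT).
have -> : \sum_(0 <= i < k) size (nth [::] T i) =
    \sum_(0 <= i < k) size (nth [::] [seq take 1 r | r <- T] i) +
    \sum_(0 <= i < k) size (nth [::] [seq behead r | r <- T] i).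
  rewrite -big_split; apply: eq_bigr => i _ /=.
  have [lt_i|le_i] := ltnP i (size T); last by rewrite !nth_default ?size_map.
  by rewrite !(nth_map [::]) //; case: (nth _ T i) => //= x r; rewrite take0.
move=> h; case/andP: hT => _ hT.
apply: leq_trans (leq_add (first_column_size k hT) h).
rewrite /greene; have hs := shuffle_first_column T.
rewrite addn_minl leq_min; apply/andP; split; last exact: chains_shuffle_size hs.
exact: chains_shuffle_decreasing hs (first_column_decreasing hT) _.
Qed.

(** The hypothesis gives [N] one chain ending at most at [e] besides those of [M]; that chain
    absorbs all of [r], and [M] is left for [w]. *)
Lemma chains_sorted e r w (N M : nat -> nat) : path leq e r -> nondec M ->
  (forall t, M t + (e <= t) <= N t) -> size r + chains w M <= chains (r ++ w) N.
Proof.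
elim: r e N => [|p r IH] e N /=.
  by move=> _ _ h; apply: chains_mono => t; have := h t; lia.
case/andP=> le_ep hr hM h; have hp := h p; rewrite le_ep in hp.
have h0 : 0 < N p by lia.
apply: leq_trans _ (chains_take _ h0); rewrite addSn ltnS; apply: (IH p) => // t.
have := h t; have := hM t p; rewrite /extend.
have [lt_tp|le_pt] := ltnP t p; first by lia.
by rewrite (leq_trans le_ep le_pt).
Qed.

(** Each of the top [k] rows gets a chain of its own. The top row is read last, so the induction
    moves it into the suffix [w], served by [j] further chains. *)
Lemma greene_row_word_ge k j w T : all (sorted leq) T ->
  \sum_(0 <= i < k) size (nth [::] T i) + greene j w <=
  greene (k + j) (row_word T ++ w).
Proof.
elim: T k j w => [|r T IH] k j w hT /=.
  rewrite big1 ?add0n; last by move=> i _; rewrite nth_nil.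
  by apply: chains_mono => t; lia.
case/andP: hT => hr hT; case: k => [|k].
  rewrite big_geq // add0n add0n row_word_cons -catA.
  have := IH 0 j (r ++ w) hT; rewrite big_geq // => h; apply: leq_trans h.
  by elim: r {hr} => //= x r h; apply: leq_trans h (leq_maxl _ _).
rewrite big_nat_recl //= row_word_cons -catA addSnnS.
apply: leq_trans (IH _ _ _ hT); rewrite addnAC addnC leq_add2l.
apply: (@chains_sorted 0) => //; last by move=> t; rewrite addn1.
by case: r hr.
Qed.

Lemma greene_row_word k T : semistandard T ->
  greene k (row_word T) = \sum_(0 <= i < k) size (nth [::] T i).
Proof.
move=> hT; apply/eqP; rewrite eqn_leq greene_row_word_le //=.
case/andP: hT => hT _.
by have := greene_row_word_ge k 0 [::] hT; rewrite addn0 cats0 addn0.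
Qed.

(** * Reversal *)

Definition state k (N : nat -> nat) := nondec N /\ forall t, N t <= k.

(* The condition [N1 p.-1 < N p], which says that [N1] is at most [extend p N],
   is symmetric under [dual] below; this makes reachability reversible. *)
Inductive reach k : seq nat -> (nat -> nat) -> (nat -> nat) -> nat -> Prop :=
| Reach_nil N M : (forall t, M t <= N t) -> reach k [::] N M 0
| Reach_skip p w N M n : reach k w N M n -> reach k (p :: w) N M n
| Reach_take p w N N1 M n : state k N1 -> (forall t, N1 t <= N t) ->
    N1 p.-1 < N p -> reach k w N1 M n -> reach k (p :: w) N M n.+1.

Lemma reach_rcons_skip k p w N M n : reach k w N M n -> reach k (rcons w p) N M n.
Proof.
elim=> {w N M n} [N M h|q w N M n _ IH|q w N N1 M n hN1 le1 lt1 _ IH] /=.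
- by apply: Reach_skip; exact: Reach_nil.
- exact: Reach_skip.
- exact: Reach_take IH.
Qed.

Lemma reach_rcons_take k p w N N1 M n : reach k w N N1 n -> state k M ->
  (forall t, M t <= N1 t) -> M p.-1 < N1 p -> reach k (rcons w p) N M n.+1.
Proof.
move=> h hM; elim: h => {w N N1 n} [N N1 h le1 lt1|q w N N1 n _ IH *|
  q w N N2 N1 n hN2 le2 lt2 _ IH *] /=.
- apply: (@Reach_take _ _ _ _ M) => //; last exact: Reach_nil.
    by move=> t; exact: leq_trans (le1 t) (h t).
  exact: leq_trans lt1 (h p).
- by apply: Reach_skip; exact: IH.
- by apply: (@Reach_take _ _ _ _ N2) => //; exact: IH.
Qed.

(** Of [k] chains, this counts those with last letter [x > m - t], that is, with [m.+1 - x <= t]: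
    the same chains seen from the other end. *)
Definition dual k m (N : nat -> nat) (t : nat) := k - N (m - t).

Lemma state_dual k m N : state k N -> state k (dual k m N).
Proof.
case=> hN _; split=> [s t le_st|t]; last exact: leq_subr.
by apply/leq_sub2l/hN/leq_sub2l.
Qed.

Lemma RC_cons m p w : RC m (p :: w) = rcons (RC m w) (m.+1 - p).
Proof. by rewrite /RC rev_cons map_rcons. Qed.

Lemma reach_RC k m w N M n : word_le m w -> state k N -> reach k w N M n ->
  reach k (RC m w) (dual k m M) (dual k m N) n.
Proof.
move=> hw hN h; elim: h hw hN => {w N M n} [N M h _ _|p w N M n _ IH|
    p w N N1 M n hN1 le1 lt1 _ IH].
- by apply: Reach_nil => t; exact/leq_sub2l/h.
- by rewrite RC_cons => /andP [_ hw] hN; exact/reach_rcons_skip/IH.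
rewrite RC_cons => /andP [/andP [p_gt0 le_pm] hw] hN.
apply: reach_rcons_take (IH hw hN1) _ _ _; first exact: state_dual.
  by move=> t; exact/leq_sub2l/le1.
rewrite /dual.
have -> : m - (m.+1 - p).-1 = p by lia.
have -> : m - (m.+1 - p) = p.-1 by lia.
(* The bound [N p <= k] keeps the inequality strict under truncated subtraction from [k]. *)
by have := hN.2 p; lia.
Qed.

Lemma reach_chains k w N M n : reach k w N M n -> n <= chains w N.
Proof.
elim=> {w N M n} [//|p w N M n _ IH|p w N N1 M n [hN1 _] le1 lt1 _ IH].
  exact: leq_trans IH (chains_skip _ _ _).
have h : 0 < N p by lia.
take_letter h; apply: leq_trans IH _; apply: chains_mono => t.
have := le1 t; have := le1 p; have := hN1 t p.-1.
by extend_lia.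
Qed.

Lemma chains_reach k w N : is_word w -> state k N ->
  reach k w N (fun=> 0) (chains w N).
Proof.
elim: w N => [N _ _|p w IH N /andP [p_gt0 hw] hN]; first exact: Reach_nil.
have [->|[h ->]] := chains_cons p w N; first exact/Reach_skip/IH.
have hN1 : state k (extend p N).
  split; first by apply: extend_nondec; case: hN.
  by move=> t; exact: leq_trans (extend_le _ _ _) (hN.2 t).
(* Since [p] is positive, [p.-1 < p], so [extend p N] is at most [(N p).-1] at [p.-1]. *)
apply: (Reach_take hN1) (IH _ hw hN1); first exact: extend_le.
by extend_lia.
Qed.

Lemma word_le_is_word m w : word_le m w -> is_word w.
Proof. by apply: sub_all => x /andP []. Qed.

Lemma RC_cat m v w : RC m (v ++ w) = RC m w ++ RC m v.
Proof. by rewrite /RC rev_cat map_cat. Qed.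

Lemma RC_word_le m w : word_le m w -> word_le m (RC m w).
Proof.
move=> hw; rewrite /word_le all_map all_rev; apply: sub_all hw => x /=.
by case/andP=> *; apply/andP; split; lia.
Qed.

Lemma RC_K m w : word_le m w -> RC m (RC m w) = w.
Proof.
move=> /allP hw; rewrite /RC -map_rev revK -map_comp -[RHS]map_id.
apply/eq_in_map => x /hw /andP [? ?] /=; lia.
Qed.

(** A selection run backwards is a selection in [RC m w] of the same size; as [RC m] is an
    involution, one inequality suffices. *)
Lemma greene_RC k m w : word_le m w -> greene k (RC m w) = greene k w.
Proof.
have le_RC v : word_le m v -> greene k v <= greene k (RC m v).
  move=> hv; have hK : state k (fun=> k) by split.
  have := chains_reach (word_le_is_word hv) hK.
  move=> /(reach_RC hv hK) /reach_chains h; apply: leq_trans h _.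
  by apply: chains_mono => t; exact: leq_subr.
move=> hw; apply/eqP; rewrite eqn_leq le_RC // andbT.
by rewrite -{2}(RC_K hw) le_RC // RC_word_le.
Qed.

(** * Uncrossing *)

(* Sort both families of chains by last letter and recombine them so that one
   new family follows the componentwise maximum and the other the minimum of
   the last letters. The condition on [A] and [B] lets the first one take every
   letter above [m] taken by [A]. *)
Lemma chains_uncross m w (A B : nat -> nat) : nondec A -> nondec B ->
  (forall t, m <= t -> A t <= B t) ->
  chains w A + chains (upto m w) B <=
  chains w (fun t => minn (A t) (B t)) +
  chains (upto m w) (fun t => maxn (A t) (B t)).
Proof.
elim: w A B => [//|p w IH] A B hA hB hAB.
set I := (fun t => minn (A t) (B t)); set U := (fun t => maxn (A t) (B t)).
have IHle A' B' I' U' : nondec A' -> nondec B' ->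
    (forall t, m <= t -> A' t <= B' t) ->
    (forall t, minn (A' t) (B' t) <= I' t) ->
    (forall t, maxn (A' t) (B' t) <= U' t) ->
    chains w A' + chains (upto m w) B' <= chains w I' + chains (upto m w) U'.
  move=> hA' hB' hAB' hI hU; apply: leq_trans (IH _ _ hA' hB' hAB') _.
  by apply: leq_add; exact: chains_mono.
have eA := extend_nondec p hA; have eB := extend_nondec p hB.
have [le_pm|lt_mp] := leqP p m; last first.
  have -> : upto m (p :: w) = upto m w by rewrite /upto /= leqNgt lt_mp.
  have [->|[h ->]] := chains_cons p w A.
    by apply: leq_trans (IH _ _ hA hB hAB) _; rewrite leq_add2r chains_skip.
  have hp : A p <= B p by apply: hAB; lia.
  have hI : 0 < I p by rewrite /I; lia.
  apply: leq_trans (leq_add (chains_take _ hI) (leqnn _)); rewrite !addSn ltnS.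
  apply: IHle => // t => [le_mt||]; have := extend_le p A t.
  - by have := hAB t le_mt; lia.
  - by rewrite /I; extend_lia.
  - by rewrite /U; lia.
have -> : upto m (p :: w) = p :: upto m w by rewrite /upto /= le_pm.
have sI := chains_skip p w I; have sU := chains_skip p (upto m w) U.
have tI := @chains_take p w I; have tU := @chains_take p (upto m w) U.
have [->|[hAp ->]] := chains_cons p w A;
  have [->|[hBp ->]] := chains_cons p (upto m w) B.
- by apply: leq_trans (IH _ _ hA hB hAB) (leq_add sI sU).
- have hAB' t : m <= t -> A t <= extend p B t by have := hAB t; extend_lia.
  (* If just one family takes [p], then [I] takes it when that family has the smaller count at [p],
     and [U] takes it otherwise. *)
  have [le_BA|lt_AB] := leqP (B p) (A p).
    have hI : 0 < I p by rewrite /I; lia.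
    have : chains w A + chains (upto m w) (extend p B) <=
        chains w (extend p I) + chains (upto m w) U; last by have := tI hI; lia.
    apply: IHle => // t; have := extend_le p B t; rewrite /I /U; last by lia.
    by extend_lia.
  have hU : 0 < U p by rewrite /U; lia.
  have : chains w A + chains (upto m w) (extend p B) <=
      chains w I + chains (upto m w) (extend p U); last by have := tU hU; lia.
  apply: IHle => // t; have := extend_le p B t; rewrite /I /U; first by lia.
  by have := hA t p; extend_lia.
- have hAB' t : m <= t -> extend p A t <= B t by have := hAB t; extend_lia.
  have [le_AB|lt_BA] := leqP (A p) (B p).
    have hI : 0 < I p by rewrite /I; lia.
    have : chains w (extend p A) + chains (upto m w) B <=
        chains w (extend p I) + chains (upto m w) U; last by have := tI hI; lia.
    apply: IHle => // t; have := extend_le p A t; rewrite /I /U; last by lia.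
    by extend_lia.
  have hU : 0 < U p by rewrite /U; lia.
  have : chains w (extend p A) + chains (upto m w) B <=
      chains w I + chains (upto m w) (extend p U); last by have := tU hU; lia.
  apply: IHle => // t; have := extend_le p A t; rewrite /I /U; first by lia.
  by have := hB t p; extend_lia.
have hI : 0 < I p by rewrite /I; lia.
have hU : 0 < U p by rewrite /U; lia.
have : chains w (extend p A) + chains (upto m w) (extend p B) <=
    chains w (extend p I) + chains (upto m w) (extend p U);
  last by have := tU hU; have := tI hI; lia.
apply: IHle => // t => [le_mt||].
- by have := hAB t le_mt; extend_lia.
- by rewrite /I; extend_lia.
- by rewrite /U; extend_lia.
Qed.

(** If [x] is taken on the left, uncross the constant family [k] with its extension by [x]: they
    agree from [m] on, their minimum is the extension and their maximum the constant. *)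
Lemma greene_cons_supermodular k m x w : x <= m ->
  greene k (x :: upto m w) + greene k w <= greene k (x :: w) + greene k (upto m w).
Proof.
move=> le_xm; rewrite /greene.
have s := chains_skip x w (fun=> k).
have [->|[h ->]] := chains_cons x (upto m w) (fun=> k); first by lia.
have t := @chains_take x w _ h.
have : chains w (fun=> k) + chains (upto m w) (extend x (fun=> k)) <=
    chains w (extend x (fun=> k)) + chains (upto m w) (fun=> k); last by lia.
apply: leq_trans (chains_uncross _ _ _ _) _ => //; first exact: extend_nondec.
  by move=> t' le_mt; extend_lia.
by apply: leq_add; apply: chains_mono => t'; extend_lia.
Qed.

Lemma upto_cat j v w : upto j (v ++ w) = upto j v ++ upto j w.
Proof. exact: filter_cat. Qed.

Lemma upto_word_le j m w : m <= j -> word_le m w -> upto j w = w.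
Proof.
move=> le_mj /allP hw; apply/all_filterP/allP => x /hw /andP [_ le_xm].
exact: leq_trans le_mj.
Qed.

(** The first [k] rows of [P(w)] hold [greene k w - greene k (upto m w)] letters above [m];
    multiplying by [u] on the left does not decrease this number. *)
Lemma greene_cat_supermodular k m u w : word_le m u ->
  greene k (u ++ upto m w) + greene k w <= greene k (u ++ w) + greene k (upto m w).
Proof.
elim: u => [|x u IH] /=; first by rewrite addnC.
case/andP=> /andP [_ le_xm] hu; have := IH hu.
have := greene_cons_supermodular k (u ++ w) le_xm.
by rewrite upto_cat (upto_word_le (leqnn m) hu); lia.
Qed.

(** * Insertion and Knuth equivalence *)

Lemma knuth_refl w : knuth_equiv w w. Proof. exact: rst_refl. Qed.

Lemma knuth_sym v w : knuth_equiv v w -> knuth_equiv w v.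
Proof. exact: rst_sym. Qed.

Lemma knuth_trans u v w : knuth_equiv u v -> knuth_equiv v w -> knuth_equiv u w.
Proof. exact: rst_trans. Qed.

Lemma knuth_cat v v' w w' :
  knuth_equiv v v' -> knuth_equiv w w' -> knuth_equiv (v ++ w) (v' ++ w').
Proof.
move=> hv hw; apply: (@knuth_trans _ (v' ++ w)).
  elim: hv => [s t h|s|s t _|r s t _ + _]; last exact: knuth_trans.
  - by apply: rst_step; case: h => x y a b c h1 h2; rewrite -!catA; constructor.
  - exact: knuth_refl.
  - exact: knuth_sym.
elim: hw => [s t h|s|s t _|r s t _ + _]; last exact: knuth_trans.
- by apply: rst_step; case: h => x y a b c h1 h2;
    rewrite (catA v' x) (catA v' x); constructor.
- exact: knuth_refl.
- exact: knuth_sym.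
Qed.

Lemma knuth_context x y v w :
  knuth_equiv v w -> knuth_equiv (x ++ v ++ y) (x ++ w ++ y).
Proof. by move=> h; do 2 (apply: knuth_cat => //; try exact: knuth_refl). Qed.

Lemma knuth_step_perm v w : knuth_step v w -> perm_eq v w.
Proof.
case=> x y a b c _ _; rewrite perm_cat2l perm_cat2r; apply/permP => p /=; lia.
Qed.

Lemma knuth_perm v w : knuth_equiv v w -> perm_eq v w.
Proof.
elim=> {v w} [v w /knuth_step_perm //|v|v w _|u v w _ + _]; first exact: perm_refl.
  by rewrite perm_sym.
exact: perm_trans.
Qed.

Lemma knuth_upto j v w : knuth_equiv v w -> knuth_equiv (upto j v) (upto j w).
Proof.
elim=> {v w} [v w h|v|v w _|u v w _ + _]; last exact: knuth_trans.
- case: h => x y a b c h1 h2; rewrite !upto_cat; apply: knuth_context;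
    rewrite /upto /=; case: (leqP c j) => hc; try exact: knuth_refl;
    (have -> : a <= j by lia); (have -> : b <= j by lia); apply: rst_step.
  + exact: (@Knuth_acb [::] [::]).
  + exact: (@Knuth_bac [::] [::]).
- exact: knuth_refl.
- exact: knuth_sym.
Qed.

(** Reversing and complementing exchanges the two Knuth relations. *)
Lemma knuth_step_RC m v w : word_le m v -> knuth_step v w ->
  knuth_equiv (RC m v) (RC m w).
Proof.
move=> hv h; case: h hv => x y a b c h1 h2;
  rewrite /word_le !all_cat => /and3P [_ h _];
  rewrite !RC_cat -!catA; apply: knuth_context; apply: rst_step.
- by apply: (@Knuth_bac [::] [::]); move: h => /=; lia.
- by apply: (@Knuth_acb [::] [::]); move: h => /=; lia.
Qed.

Lemma knuth_RC m v w : word_le m v -> knuth_equiv v w ->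
  knuth_equiv (RC m v) (RC m w).
Proof.
move=> hv h; elim: h hv => {v w} [v w h hv|v _|v w h IH hw|u v w h IH1 _ IH2 hu].
- exact: knuth_step_RC.
- exact: knuth_refl.
- by apply/knuth_sym/IH; rewrite /word_le (perm_all _ (knuth_perm h)).
- apply: knuth_trans (IH1 hu) (IH2 _).
  by rewrite /word_le -(perm_all _ (knuth_perm h)).
Qed.

Lemma row_insert_none x r s :
  row_insert x r = (s, None) -> s = rcons r x /\ all (leq^~ x) r.
Proof.
elim: r s => [|z r IH] s /=; first by case=> <-.
case: ltnP => // le_zx; case E: (row_insert x r) => [s' o] [<- eo].
by rewrite eo in E; have [-> ->] := IH _ E.
Qed.

Lemma row_insert_gt x r s y : row_insert x r = (s, Some y) -> x < y.
Proof.
elim: r s => [|z r IH] s //=.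
case: ltnP => [lt_xz [_ <-] //|_]; case E: (row_insert x r) => [s' o] [_ eo].
by rewrite eo in E; exact: IH E.
Qed.

(** Each entry that [x] passes is at least its left neighbour, which exceeds [x], so each move is a
    [Knuth_bac] step. *)
Lemma knuth_shift_left x z r : path leq z r -> x < z ->
  knuth_equiv (z :: r ++ [:: x]) (z :: x :: r).
Proof.
elim: r z => [|q r IH] z /=; first by move=> *; exact: knuth_refl.
case/andP=> le_zq hr lt_xz.
apply: (@knuth_trans _ [:: z, q, x & r]).
  have lt_xq : x < q := leq_trans lt_xz le_zq.
  exact: (@knuth_cat [:: z] _ _ _ (knuth_refl _) (IH _ hr lt_xq)).
by apply/knuth_sym/rst_step; exact: (@Knuth_bac [::] r).
Qed.

Lemma knuth_row_insert x r s y : sorted leq r -> row_insert x r = (s, Some y) ->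
  knuth_equiv (r ++ [:: x]) (y :: s).
Proof.
elim: r s => [|z r IH] s //= hr.
case: ltnP => [lt_xz [<- <-]|le_zx]; first exact: knuth_shift_left.
case E: (row_insert x r) => [s' o] [<- eo]; rewrite eo in E.
apply: (@knuth_trans _ [:: z, y & s']).
  exact: (@knuth_cat [:: z] _ _ _ (knuth_refl _) (IH _ (path_sorted hr) E)).
(* The head [h] of the new tail is the witness that lets [y] pass [z] by a [Knuth_acb] step. *)
have [h [t [-> le_zh lt_hy]]] : exists h t, [/\ s' = h :: t, z <= h & h < y].
  case: r hr E {IH} => [|q r] //= /andP [le_zq _].
  case: ltnP => [lt_xq [<- <-]|le_qx]; first by exists x, r.
  case F: (row_insert x r) => [t u] [<- eu]; exists q, t; split=> //.
  by rewrite eu in F; exact: leq_ltn_trans le_qx (row_insert_gt F).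
by apply: rst_step; exact: (@Knuth_acb [::] t).
Qed.

Lemma path_row_insert e x r : path leq e r -> e <= x ->
  path leq e (row_insert x r).1.
Proof.
elim: r e => [|z r IH] e /=; first by move=> _ ->.
case/andP=> le_ez hr le_ex; case: ltnP => [lt_xz|le_zx] /=.
  by rewrite le_ex (path_le leq_trans (ltnW lt_xz) hr).
by have := IH _ hr le_zx; case: (row_insert x r) => s o /= ->; rewrite le_ez.
Qed.

Lemma sorted_row_insert x r : sorted leq r -> sorted leq (row_insert x r).1.
Proof.
move=> hr; apply: (@path_sorted _ _ 0); apply: path_row_insert => //.
by case: r hr.
Qed.

Lemma all_sorted_tab_insert x T :
  all (sorted leq) T -> all (sorted leq) (tab_insert x T).
Proof.
elim: T x => //= r T IH x /andP [hr hT].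
have := sorted_row_insert x hr.
by case: (row_insert x r) => s [y|] /= ->; rewrite ?IH.
Qed.

Lemma knuth_tab_insert x T : all (sorted leq) T ->
  knuth_equiv (row_word T ++ [:: x]) (row_word (tab_insert x T)).
Proof.
elim: T x => [|r T IH] x /=; first by move=> _; exact: knuth_refl.
case/andP=> hr hT; case E: (row_insert x r) => [s [y|]]; last first.
  have [-> _] := row_insert_none E.
  by rewrite !row_word_cons -catA cats1; exact: knuth_refl.
rewrite !row_word_cons -catA.
apply: (@knuth_trans _ (row_word T ++ [:: y] ++ s)).
  by apply: knuth_cat; [exact: knuth_refl|exact: knuth_row_insert].
by rewrite catA; apply: knuth_cat; [exact: IH|exact: knuth_refl].
Qed.

Lemma above_row_insert x r t : above r t -> above (row_insert x r).1 t.
Proof.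
elim: r t => [|z r IH] [|y t] //= /andP [lt_zy h]; case: ltnP => [lt_xz|le_zx] /=.
  by rewrite h andbT; exact: ltn_trans lt_zy.
by have := IH _ h; case: (row_insert x r) => s o /= ->; rewrite lt_zy.
Qed.

Lemma above_bump x r s y t : above r t -> row_insert x r = (s, Some y) ->
  above s (row_insert y t).1.
Proof.
elim: r t s => [|z r IH] t s //= ht.
case: ltnP => [lt_xz [<- <-]|le_zx].
  case: t ht => [|h t] /=; first by rewrite lt_xz.
  by case/andP=> lt_zh ht; rewrite lt_zh /= lt_xz.
case E: (row_insert x r) => [s' o] [<- eo]; rewrite eo in E.
have lt_xy := row_insert_gt E; have lt_zy := leq_ltn_trans le_zx lt_xy.
case: t ht => [|h t] /=; first by rewrite lt_zy.
case/andP=> lt_zh ht; case: ltnP => [lt_yh|le_hy] /=.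
  by rewrite lt_zy /=; have := above_row_insert x ht; rewrite E.
by have := IH _ _ ht E; case: (row_insert y t) => t' o' /= ->; rewrite lt_zh.
Qed.

Lemma path_above_tab_insert x r s y T : path above r T ->
  row_insert x r = (s, Some y) -> path above s (tab_insert y T).
Proof.
elim: T x r s y => [|t T IH] x r s y /=.
  by move=> _ /(above_bump (t := [::])) /= ->.
case/andP=> hrt hT E; have := above_bump hrt E.
case F: (row_insert y t) => [t' [z|]] /= ->; first exact: IH hT F.
case: T hT {IH} => //= t2 T /andP [h ->]; rewrite andbT.
by have := above_row_insert y h; rewrite F.
Qed.

Lemma semistandard_tab_insert x T :
  semistandard T -> semistandard (tab_insert x T).
Proof.
case/andP=> hr hc; rewrite /semistandard all_sorted_tab_insert //=.
case: T hc {hr} => //= r T hT; case E: (row_insert x r) => [s [y|]] /=.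
  exact: path_above_tab_insert hT E.
case: T hT => //= t2 T /andP [h ->]; rewrite andbT.
by have := above_row_insert x h; rewrite E.
Qed.

Definition tableau_rows (T : tableau) : bool :=
  semistandard T && all (fun r => r != [::]) T.

Lemma rskP_cat v w : rskP (v ++ w) = foldl (fun T x => tab_insert x T) (rskP v) w.
Proof. exact: foldl_cat. Qed.

Lemma rskP_tableau w : tableau_rows (rskP w).
Proof.
elim/last_ind: w => // w x /andP [hT hn]; rewrite -cats1 rskP_cat /=.
rewrite /tableau_rows semistandard_tab_insert //=.
elim: (rskP w) x hn {hT} => //= r T IH x /andP [hr hT].
have : (row_insert x r).1 != [::].
  by case: r {hr} => //= z r; case: ifP => //; case: (row_insert x r).
by case: (row_insert x r) => s [y|] /= ->; rewrite ?IH.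
Qed.

Lemma knuth_rskP w : knuth_equiv w (row_word (rskP w)).
Proof.
elim/last_ind: w => [|w x IH]; first exact: knuth_refl.
rewrite -cats1 rskP_cat /=.
apply: knuth_trans (knuth_cat IH (knuth_refl _)) (knuth_tab_insert _ _).
by case/andP: (rskP_tableau w) => /andP [].
Qed.

(** * Recovering the insertion tableau from Greene numbers *)

Lemma nth_upto j T i : nth [::] [seq upto j r | r <- T] i = upto j (nth [::] T i).
Proof.
have [lt_i|le_i] := ltnP i (size T); first exact: nth_map.
by rewrite !nth_default ?size_map.
Qed.

Lemma greene_upto_row_word j k T : semistandard T ->
  greene k (upto j (row_word T)) = \sum_(0 <= i < k) size (upto j (nth [::] T i)).
Proof.
move=> hT; rewrite upto_row_word greene_row_word ?semistandard_upto //.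
by apply: eq_bigr => i _; rewrite nth_upto.
Qed.

Lemma greene_upto j k w :
  greene k (upto j w) = \sum_(0 <= i < k) size (upto j (nth [::] (rskP w) i)).
Proof.
rewrite (knuth_greene _ _ (knuth_rskP w)) greene_upto_row_word //.
by case/andP: (rskP_tableau w).
Qed.

Lemma eq_partial_sums (f g : nat -> nat) :
  (forall k, \sum_(0 <= i < k) f i = \sum_(0 <= i < k) g i) -> f =1 g.
Proof.
by move=> h i; have := h i.+1; rewrite !big_nat_recr //= h => /addnI.
Qed.

Lemma eq_sorted_upto r s : sorted leq r -> sorted leq s ->
  (forall j, size (upto j r) = size (upto j s)) -> r = s.
Proof.
move=> hr hs h; apply: (sorted_eq leq_trans anti_leq) => //.
have split_count x t :
    size (upto x t) = count_mem x t + (if x is x'.+1 then size (upto x' t) else 0).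
  by case: x => [|x]; rewrite /upto ?size_filter; elim: t => //= y t; lia.
apply/allP => x _ /=; apply/eqP; have := h x; rewrite !split_count.
by case: x => [|x]; rewrite ?h ?addn0 // => /addIn.
Qed.

Lemma eq_tableau T1 T2 : tableau_rows T1 -> tableau_rows T2 ->
  (forall j i, size (upto j (nth [::] T1 i)) = size (upto j (nth [::] T2 i))) ->
  T1 = T2.
Proof.
move=> /andP [/andP [s1 _] n1] /andP [/andP [s2 _] n2] h.
have e i : nth [::] T1 i = nth [::] T2 i.
  have hs T : all (sorted leq) T -> sorted leq (nth [::] T i).
    by move=> hT; have [/(all_nthP [::] hT)|/(nth_default [::]) ->] := ltnP i (size T).
  by apply: eq_sorted_upto; rewrite ?hs.
have le_size T T' : all (fun r => r != [::]) T ->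
    (forall i, nth [::] T i = nth [::] T' i) -> size T <= size T'.
  move=> hT eT; rewrite leqNgt; apply/negP => lt_s.
  by have /eqP := all_nthP [::] hT _ lt_s; apply; rewrite eT nth_default.
by apply: (@eq_from_nth _ [::]) => //; apply/eqP; rewrite eqn_leq !le_size.
Qed.

Lemma rskP_row_word T : tableau_rows T -> rskP (row_word T) = T.
Proof.
move=> hT; apply: eq_tableau => [||j]; [exact: rskP_tableau|exact: hT|].
apply: eq_partial_sums => k; rewrite -greene_upto greene_upto_row_word //.
by case/andP: hT.
Qed.

Lemma eq_rskP v w :
  (forall j k, greene k (upto j v) = greene k (upto j w)) -> rskP v = rskP w.
Proof.
move=> h; apply: eq_tableau => [||j]; try exact: rskP_tableau.
by apply: eq_partial_sums => k; rewrite -!greene_upto.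
Qed.

Lemma rskP_knuth v w : rskP v = rskP w -> knuth_equiv v w.
Proof.
move=> h; apply: (knuth_trans (knuth_rskP v)); rewrite h.
exact/knuth_sym/knuth_rskP.
Qed.

Lemma knuth_eq_rskP v w : knuth_equiv v w -> rskP v = rskP w.
Proof. by move=> h; apply: eq_rskP => j k; exact: knuth_greene. Qed.

(** * Shapes and large letters *)

Definition rsk_shape w i := size (nth [::] (rskP w) i).

Definition small m (T : tableau) i := size (upto m (nth [::] T i)).

Definition large m (T : tableau) i := count (ltn m) (nth [::] T i).

Lemma size_small_large m T i : size (nth [::] T i) = small m T i + large m T i.
Proof.
rewrite /small /large size_filter -(count_predC (leq^~ m)); congr (_ + _).
by apply: eq_count => x /=; rewrite ltnNge.
Qed.

Lemma row_insert_count a x r : count a (row_insert x r).1 +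
  (if (row_insert x r).2 is Some y then a y : nat else 0) = count a r + a x.
Proof.
elim: r => [|z r IH] /=; first by lia.
case: ifP => _ /=; first by lia.
by move: IH; case: (row_insert x r) => s o /=; lia.
Qed.

(** Bumping moves letters down only, so among the letters above [m] the first [k] rows can gain only
    [x]. *)
Lemma tab_insert_large m x T k :
  \sum_(0 <= i < k) large m (tab_insert x T) i <=
  \sum_(0 <= i < k) large m T i + (m < x).
Proof.
elim: T x k => [|r T IH] x [|k]; try by rewrite big_geq.
  rewrite big_nat_recl // big1 => [|i _]; first by rewrite /large /=; lia.
  by rewrite /large /= nth_nil.
have := row_insert_count (ltn m) x r => /=.
case: (row_insert x r) => s [y|] /= h; rewrite !big_nat_recl // /large /=.
  by have := IH y k; rewrite /large; lia.
by lia.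
Qed.

(** Each bumped letter must be at most [m], so a bumping row trades one small letter for another.
    The row where the insertion ends has only entries at most the inserted letter, hence none above
    [m]. *)
Lemma tab_insert_small m x T : x <= m -> large m (tab_insert x T) =1 large m T ->
  forall i, small m (tab_insert x T) i = small m T i \/ large m T i = 0.
Proof.
elim: T x => [|r T IH] x le_xm; first by move=> _ i; right; rewrite /large nth_nil.
have hl := row_insert_count (ltn m) x r; have hs := row_insert_count (leq^~ m) x r.
move: hl hs => /=; case E: (row_insert x r) => [s [y|]] /= hl hs h.
  have le_ym : y <= m by have := h 0; rewrite /large /=; lia.
  case=> [|i]; first by left; rewrite /small /upto !size_filter /=; lia.
  by apply: (IH y le_ym) => j; exact: (h j.+1).
case=> [|i]; last by left.
have [_ /allP hr] := row_insert_none E; right; apply/eqP.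
rewrite /large /= -leqn0 leqNgt -has_count; apply/hasPn => z /hr /= le_zx.
by rewrite -leqNgt; exact: leq_trans le_xm.
Qed.

Definition insert_word := foldl (fun T x => tab_insert x T).

Lemma insert_word_large m u T k : word_le m u ->
  \sum_(0 <= i < k) large m (insert_word T u) i <= \sum_(0 <= i < k) large m T i.
Proof.
elim: u T => //= x u IH T /andP [/andP [_ le_xm] hu].
apply: leq_trans (IH _ hu) _; have := tab_insert_large m x T k.
by rewrite ltnNge le_xm addn0.
Qed.

(** No insertion increases these partial sums, so the hypothesis forces equality at every letter of
    [u] and [tab_insert_small] applies each time. *)
Lemma insert_word_small m u T : word_le m u ->
  (forall k, \sum_(0 <= i < k) large m T i <=
             \sum_(0 <= i < k) large m (insert_word T u) i) ->
  forall i, small m (insert_word T u) i = small m T i \/ large m T i = 0.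
Proof.
elim: u T => [|x u IH] T /=; first by left.
case/andP=> /andP [_ le_xm] hu h.
have e : large m (tab_insert x T) =1 large m T.
  apply: eq_partial_sums => k; have := insert_word_large (tab_insert x T) k hu.
  by have := tab_insert_large m x T k; have := h k; lia.
have h' k : \sum_(0 <= i < k) large m (tab_insert x T) i <=
    \sum_(0 <= i < k) large m (insert_word (tab_insert x T) u) i.
  by apply: leq_trans (h k); apply: leq_sum => i _; rewrite e.
move=> i; have [->|] := IH _ hu h' i; last by rewrite e; right.
exact: tab_insert_small.
Qed.

Lemma greene_shape k w : greene k w = \sum_(0 <= i < k) rsk_shape w i.
Proof.
have [hT _] := andP (rskP_tableau w); rewrite -greene_row_word //.
have h j : knuth_equiv (upto j w) (upto j (row_word (rskP w))).
  exact/knuth_upto/knuth_rskP.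
(* [knuth_greene] concerns restrictions; a large enough [j] makes them trivial on both words. *)
have hj v : exists j, forall j', j <= j' -> upto j' v = v.
  elim: v => [|x v [j hv]]; first by exists 0.
  exists (maxn x j) => j' hj'; rewrite /upto /= [filter _ _]hv; last by lia.
  by rewrite (leq_trans (leq_maxl x j) hj').
have [j1 h1] := hj w; have [j2 h2] := hj (row_word (rskP w)).
have := knuth_greene (j1 + j2) k (knuth_rskP w).
by rewrite h1 ?leq_addr // h2 ?leq_addl.
Qed.

Lemma eq_shape v w : (forall k, greene k v = greene k w) -> rsk_shape v =1 rsk_shape w.
Proof. by move=> h; apply: eq_partial_sums => k; rewrite -!greene_shape. Qed.

Lemma shape_knuth v w : knuth_equiv v w -> rsk_shape v =1 rsk_shape w.
Proof. by move=> h i; rewrite /rsk_shape (knuth_eq_rskP h). Qed.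

Lemma shape_RC m w : word_le m w -> rsk_shape (RC m w) =1 rsk_shape w.
Proof. by move=> h; apply: eq_shape => k; exact: greene_RC. Qed.

Lemma small_shape m w : small m (rskP w) =1 rsk_shape (upto m w).
Proof. by apply: eq_partial_sums => k; rewrite -greene_shape greene_upto. Qed.

Lemma shape_small_large m w i :
  rsk_shape w i = rsk_shape (upto m w) i + large m (rskP w) i.
Proof. by rewrite -small_shape -size_small_large. Qed.

Lemma shape_upto m w i : rsk_shape (upto m w) i <= rsk_shape w i.
Proof. by rewrite (shape_small_large m w) leq_addr. Qed.

Lemma row_insert_size x r : size r <= size (row_insert x r).1.
Proof.
by elim: r => //= z r; case: ifP => // _; case: (row_insert x r).
Qed.

Lemma tab_insert_size x T i :
  size (nth [::] T i) <= size (nth [::] (tab_insert x T) i).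
Proof.
elim: T x i => [|r T IH] x i; first by rewrite nth_nil.
rewrite /=; have := row_insert_size x r.
by case: (row_insert x r) => s [y|] /= h; case: i => //= i; exact: IH.
Qed.

Lemma shape_catl v w i : rsk_shape v i <= rsk_shape (v ++ w) i.
Proof.
elim/last_ind: w => [|w x IH]; first by rewrite cats0.
apply: leq_trans IH _; rewrite -cats1 catA /rsk_shape.
by rewrite [rskP ((v ++ w) ++ _)]rskP_cat tab_insert_size.
Qed.

Lemma is_word_word_le w : is_word w -> exists m, word_le m w.
Proof.
elim: w => [|x w IH] /=; first by exists 0.
case/andP=> x_gt0 /IH [m hm]; exists (maxn x m).
rewrite x_gt0 leq_maxl /=; apply: sub_all hm => y /andP [-> le_ym].
exact: leq_trans (leq_maxr _ _).
Qed.

(** Reversal preserves shapes and turns the suffix [w] into a prefix. *)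
Lemma shape_catr v w i : is_word (v ++ w) -> rsk_shape w i <= rsk_shape (v ++ w) i.
Proof.
move=> /is_word_word_le [m h]; rewrite -[X in _ <= X](shape_RC h) RC_cat.
apply: leq_trans (shape_catl _ _ _).
by rewrite shape_RC //; move: h; rewrite /word_le all_cat => /andP [].
Qed.

Lemma size_row_word T k : size T <= k ->
  \sum_(0 <= i < k) size (nth [::] T i) = size (row_word T).
Proof.
elim: T k => [|r T IH] k hk; first by rewrite big1 // => i _; rewrite nth_nil.
by case: k hk => // k hk; rewrite big_nat_recl //= IH // row_word_cons size_cat addnC.
Qed.

Lemma sum_shape w k : size (rskP w) <= k -> \sum_(0 <= i < k) rsk_shape w i = size w.
Proof.
by move=> h; rewrite size_row_word // -(perm_size (knuth_perm (knuth_rskP w))).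
Qed.

(* In [P (x ++ u)] the letters above [m] lie weakly lower than in [P x], in
   [P (u ++ x)] weakly higher; hence they do not move, and the boxes created
   among the letters at most [m] avoid the rows where there are such letters. *)
Lemma commute_shapes m u x i : word_le m u -> knuth_equiv (u ++ x) (x ++ u) ->
  rsk_shape (upto m x ++ u) i = rsk_shape (upto m x) i \/ rsk_shape x i = rsk_shape (upto m x) i.
Proof.
move=> hu hc; have eu := upto_word_le (leqnn m) hu.
have hD w k : greene k w =
    greene k (upto m w) + \sum_(0 <= i < k) large m (rskP w) i.
  rewrite !greene_shape -big_split; apply: eq_bigr => l _.
  exact: shape_small_large.
have h k : \sum_(0 <= i < k) large m (rskP x) i <=
    \sum_(0 <= i < k) large m (insert_word (rskP x) u) i.
  rewrite -[insert_word _ _]rskP_cat -(knuth_eq_rskP hc).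
  have := greene_cat_supermodular k x hu; rewrite (hD x) (hD (u ++ x)).
  by rewrite upto_cat eu; lia.
have [|h0] := insert_word_small hu h i.
  rewrite -[insert_word _ _]rskP_cat !small_shape upto_cat eu; by left.
by right; rewrite (shape_small_large m) h0 addn0.
Qed.

Lemma eq_sum_le (f g : nat -> nat) n : (forall i, f i <= g i) ->
  \sum_(0 <= i < n) f i = \sum_(0 <= i < n) g i -> forall i, i < n -> f i = g i.
Proof.
move=> le_fg; elim: n => // n IH; rewrite !big_nat_recr //= => h i.
have le_sum : \sum_(0 <= i < n) f i <= \sum_(0 <= i < n) g i by exact: leq_sum.
have le_n := le_fg n.
rewrite ltnS leq_eqVlt => /orP [/eqP ->|]; first by lia.
by apply: IH; lia.
Qed.

(** This says that [P(w')] is [tau m] of [P(w)]: the small letters are reversed and the larger ones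
    keep their boxes. As a symmetric relation on words it serves both inclusions. *)
Definition twin m w w' :=
  knuth_equiv (upto m w') (RC m (upto m w)) /\
  forall j k, m <= j -> greene k (upto j w') = greene k (upto j w).

Lemma upto_upto i j w : i <= j -> upto i (upto j w) = upto i w.
Proof.
move=> le_ij; rewrite /upto -filter_predI; apply: eq_filter => x /=; lia.
Qed.

Lemma is_word_upto m w : is_word w -> word_le m (upto m w).
Proof.
by move/allP=> hw; apply/allP => x; rewrite mem_filter => /andP [-> /hw ->].
Qed.

Lemma twin_sym m w w' : is_word w -> is_word w' -> twin m w w' -> twin m w' w.
Proof.
move=> hw hw' [h1 h2]; split=> [|j k le_mj]; last by rewrite h2.
have := knuth_RC (is_word_upto m hw') h1.
by rewrite (RC_K (is_word_upto m hw)) => /knuth_sym.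
Qed.

Lemma twin_unique m w w1 w2 : twin m w w1 -> twin m w w2 -> rskP w1 = rskP w2.
Proof.
move=> [h1 g1] [h2 g2]; apply: eq_rskP => j k.
have [le_mj|/ltnW le_jm] := leqP m j; first by rewrite g1 ?g2.
rewrite -(upto_upto w1 le_jm) -(upto_upto w2 le_jm).
exact: knuth_greene (knuth_trans h1 (knuth_sym h2)).
Qed.

Lemma is_word_cat v w : is_word (v ++ w) = is_word v && is_word w.
Proof. exact: all_cat. Qed.

(** For [j <= m] the commutation of [u] and [y] is reversed. For [j >= m] both products turn out to
    have the shape of [y ++ u] plus that of [x] minus that of [y], row by row. *)
Lemma twin_commute m u w w' : word_le m u -> is_word w -> is_word w' ->
  twin m w w' -> knuth_equiv (u ++ w) (w ++ u) ->
  knuth_equiv (RC m u ++ w') (w' ++ RC m u).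
Proof.
move=> hu hw hw' [hl hg] hc; apply: rskP_knuth; apply: eq_rskP => j k.
set u' := RC m u; have hu' : word_le m u' := RC_word_le hu.
set y := upto m w; set y' := upto m w'.
have hy : word_le m y := is_word_upto m hw.
have eu := upto_word_le (leqnn m) hu; have eu' := upto_word_le (leqnn m) hu'.
have hcy : knuth_equiv (u ++ y) (y ++ u).
  by have := knuth_upto m hc; rewrite !upto_cat eu.
have hyu : word_le m (y ++ u) by rewrite /word_le all_cat; apply/andP.
have hR1 : knuth_equiv (u' ++ y') (RC m (y ++ u)).
  by rewrite RC_cat; apply: knuth_cat => //; exact: knuth_refl.
have hR2 : knuth_equiv (RC m (y ++ u)) (y' ++ u').
  apply: (knuth_trans (knuth_RC hyu (knuth_sym hcy))); rewrite RC_cat.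
  by apply: knuth_cat; [exact: knuth_sym|exact: knuth_refl].
have [le_mj|/ltnW le_jm] := leqP m j; last first.
  rewrite -(upto_upto (u' ++ w') le_jm) -(upto_upto (w' ++ u') le_jm).
  rewrite !(upto_cat m) eu' -/y'.
  exact: knuth_greene (knuth_trans hR1 hR2).
set x := upto j w; set x' := upto j w'.
have ey : upto m x = y := upto_upto w le_mj.
have ey' : upto m x' = y' := upto_upto w' le_mj.
have hxx : rsk_shape x' =1 rsk_shape x by apply: eq_shape => l; exact: hg.
have hcx : knuth_equiv (u ++ x) (x ++ u).
  by have := knuth_upto j hc; rewrite !upto_cat (upto_word_le le_mj hu).
have shR : rsk_shape (RC m (y ++ u)) =1 rsk_shape (y ++ u) := shape_RC hyu.
(* In each row [commute_shapes] makes [y ++ u] or [x] as long as [y], which gives one inequality;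
   the total sizes agree, so it is an equality. *)
have key z : (forall i, rsk_shape x i <= rsk_shape z i) ->
    rsk_shape (upto m z) =1 rsk_shape (y ++ u) -> size z = size u + size x' ->
    forall i, rsk_shape (y ++ u) i + rsk_shape x i = rsk_shape z i + rsk_shape y i.
  move=> le_xz e_z size_z i.
  have le_i l : rsk_shape (y ++ u) l + rsk_shape x l <= rsk_shape z l + rsk_shape y l.
    have := le_xz l; have := shape_upto m z l; rewrite e_z.
    by have := commute_shapes l hu hcx; rewrite ey; case=> ->; lia.
  (* [n] exceeds [i] and the number of rows of each tableau, so the sums are word lengths. *)
  set n := (i + size (rskP (y ++ u)) + size (rskP x) + size (rskP x') +
            size (rskP z) + size (rskP y)).+1.
  apply: (@eq_sum_le (fun l => rsk_shape (y ++ u) l + rsk_shape x l)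
    (fun l => rsk_shape z l + rsk_shape y l) n) => //; last by rewrite /n; lia.
  rewrite !big_split /= !sum_shape; try by rewrite /n; lia.
  have sx : \sum_(0 <= l < n) rsk_shape x l = \sum_(0 <= l < n) rsk_shape x' l.
    by apply: eq_bigr => l _; rewrite hxx.
  move: sx; rewrite !sum_shape; try by rewrite /n; lia.
  by rewrite size_z size_cat; lia.
rewrite !(upto_cat j) (upto_word_le le_mj hu') -/x'.
have sz : size u' = size u by rewrite /u' /RC size_map size_rev.
have k1 := key (u' ++ x'); have k2 := key (x' ++ u').
rewrite !greene_shape; apply: eq_bigr => i _.
suff : rsk_shape (u' ++ x') i + rsk_shape y i = rsk_shape (x' ++ u') i + rsk_shape y i by lia.
rewrite -k1 => [|l|l|]; last by rewrite size_cat sz.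
- rewrite -k2 // => [l|l|]; last by rewrite size_cat sz addnC.
    by rewrite -hxx shape_catl.
  by rewrite upto_cat ey' eu' -(shape_knuth hR2) shR.
- rewrite -hxx; apply: shape_catr; rewrite is_word_cat (word_le_is_word hu') /=.
  by apply/allP => a; rewrite mem_filter => /andP [_]; exact: (allP hw').
- by rewrite upto_cat ey' eu' (shape_knuth hR1) shR.
Qed.

(** * The tableau [tau m T] *)

Definition above_m m (r : seq nat) := [seq x <- r | m < x].

Lemma sorted_cat_small_large m r s : sorted leq r -> sorted leq s ->
  all (leq^~ m) r -> all (ltn m) s -> sorted leq (r ++ s).
Proof.
rewrite !(sorted_pairwise leq_trans) pairwise_cat => -> -> hr hs; rewrite !andbT.
apply/allrelP => x z /(allP hr) /= le_xm /(allP hs) /= lt_mz.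
exact: leq_trans le_xm (ltnW lt_mz).
Qed.

Lemma sorted_split m r : sorted leq r -> upto m r ++ above_m m r = r.
Proof.
move=> hr; apply: (sorted_eq leq_trans anti_leq) => //.
  apply: (@sorted_cat_small_large m); rewrite ?filter_all //;
    exact: sorted_filter leq_trans _ _ hr.
rewrite /above_m (eq_filter (a2 := predC (leq^~ m))) => [|x /=]; last exact: ltnNge.
by rewrite /upto; exact/permPl/perm_filterC.
Qed.

(** A column of the new rows lies in [r] and [r'], or has a small entry over a large one, or has two
    large entries in their old places. *)
Lemma above_replace m r s r' s' t t' :
  size r = size t -> size r' = size t' -> all (leq^~ m) r -> all (ltn m) s' ->
  above r r' -> above (t ++ s) (t' ++ s') -> above (r ++ s) (r' ++ s').
Proof.
move=> er er' hr hs' /aboveP [h1 h2] /aboveP [h3 h4].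
move: h3 h4; rewrite !size_cat -er -er' => h3 h4.
apply/aboveP; rewrite !size_cat; split=> // i hi.
have := h4 i hi; rewrite !nth_cat -er -er'.
have [lt_i|le_i] := ltnP i (size r'); first by rewrite (leq_trans lt_i h1) h2.
have [lt_i'|//] := ltnP i (size r); move=> _.
have /(allP hr) /= le_m := mem_nth 0 lt_i'.
apply: leq_ltn_trans le_m _; apply: (all_nthP 0 hs'); lia.
Qed.

Lemma row_word_nil S : (forall i, nth [::] S i = [::]) -> row_word S = [::].
Proof.
elim: S => //= r S IH h; rewrite row_word_cons IH => [|i]; last exact: (h i.+1).
exact: (h 0).
Qed.

(** Comparing by [nth] lets the two lists differ in trailing empty rows. *)
Lemma eq_row_word S S' : nth [::] S =1 nth [::] S' -> row_word S = row_word S'.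
Proof.
elim: S S' => [|r S IH] [|r' S'] h //.
- by rewrite [RHS]row_word_nil // => i; rewrite -h nth_nil.
- by rewrite row_word_nil // => i; rewrite h nth_nil.
have /= -> := h 0; rewrite !row_word_cons (IH S') // => i; exact: (h i.+1).
Qed.

Lemma row_word_nonempty S : row_word [seq r <- S | r != [::]] = row_word S.
Proof.
elim: S => //= r S IH; case: eqP => [->|_] /=; rewrite !row_word_cons IH //.
by rewrite cats0.
Qed.

Lemma mem_row_word T i x : x \in nth [::] T i -> x \in row_word T.
Proof.
elim: T i => [|r T IH] [|i] //=; rewrite row_word_cons mem_cat.
  by move=> ->; rewrite orbT.
by move=> /IH ->.
Qed.

Lemma row_wordP T x : reflect (exists i, x \in nth [::] T i) (x \in row_word T).
Proof.
apply: (iffP idP) => [|[i]]; last exact: mem_row_word.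
elim: T => // r T IH; rewrite row_word_cons mem_cat => /orP [/IH [i hi]|hx].
  by exists i.+1.
by exists 0.
Qed.

Section Tau.
Variables (m : nat) (w : seq nat).
Hypothesis hw : is_word w.

Let T := rskP w.
Let v := upto m (row_word T).
Let E := epsilon m (tab_le m T).

Let kv : knuth_equiv v (upto m w).
Proof. exact/knuth_upto/knuth_sym/knuth_rskP. Qed.

Let hv : word_le m v.
Proof. by rewrite /word_le (perm_all _ (knuth_perm kv)); exact: is_word_upto. Qed.

Let eE : E = rskP (RC m v).
Proof. by rewrite /E /epsilon /tab_le row_word_nonempty -upto_row_word. Qed.

Let E_le i : all (fun x => 0 < x <= m) (nth [::] E i).
Proof.
apply/allP => x /mem_row_word; rewrite eE.
rewrite -(perm_mem (knuth_perm (knuth_rskP _))).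
exact: (allP (RC_word_le hv)).
Qed.

Let E_small i : all (leq^~ m) (nth [::] E i).
Proof. by apply: sub_all (E_le i) => x /andP []. Qed.

Let size_E i : size (nth [::] E i) = size (upto m (nth [::] T i)).
Proof.
rewrite eE -[LHS]/(rsk_shape (RC m v) i) (shape_RC hv) (shape_knuth kv).
by rewrite -small_shape.
Qed.

Let nth_tau i : nth [::] (tau m T) i = nth [::] E i ++ above_m m (nth [::] T i).
Proof.
have [lt_i|le_i] := ltnP i (size T); first by rewrite nth_mkseq.
(* Beyond the last row of [T], the row of [E] is empty too by [size_E]. *)
rewrite nth_default ?size_mkseq // [nth [::] T i]nth_default // cats0.
by apply/esym/nilP; rewrite /nilp size_E [nth [::] T i]nth_default.
Qed.

Let T_sorted i : sorted leq (nth [::] T i).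
Proof.
have /andP [/andP [hT _] _] := rskP_tableau w.
by have [/(all_nthP [::] hT)|/(nth_default [::]) ->] := ltnP i (size T).
Qed.

Let E_sorted i : sorted leq (nth [::] E i).
Proof.
have /andP [/andP [hT _] _] := rskP_tableau (RC m v); rewrite -eE in hT.
by have [/(all_nthP [::] hT)|/(nth_default [::]) ->] := ltnP i (size E).
Qed.

Let E_above i : above (nth [::] E i) (nth [::] E i.+1).
Proof.
have /andP [/andP [_ /(sortedP [::]) hE] _] := rskP_tableau (RC m v).
rewrite -eE in hE; have [/hE //|le_i] := ltnP i.+1 (size E).
by rewrite [nth _ _ i.+1]nth_default.
Qed.

Let size_tau_row i : size (nth [::] (tau m T) i) = size (nth [::] T i).
Proof. by rewrite nth_tau size_cat size_E -size_cat sorted_split. Qed.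

Lemma tau_tableau : tableau_rows (tau m T).
Proof.
have /andP [/andP [_ /(sortedP [::]) hT] hn] := rskP_tableau w.
apply/andP; split; [apply/andP; split|].
- apply/(all_nthP [::]) => i _; rewrite nth_tau.
  apply: sorted_cat_small_large (E_sorted i) _ (E_small i) (filter_all _ _).
  exact: sorted_filter leq_trans _ _ (T_sorted i).
- apply/(sortedP [::]) => i; rewrite size_mkseq => lt_i; rewrite !nth_tau.
  apply: (above_replace (size_E i) (size_E i.+1) (E_small i) (filter_all _ _)) => //.
  by rewrite !sorted_split //; exact: hT.
- apply/(all_nthP [::]) => i; rewrite size_mkseq => lt_i.
  rewrite -size_eq0 size_tau_row size_eq0; exact: (all_nthP [::] hn).
Qed.

Lemma is_word_tau : is_word (row_word (tau m T)).
Proof.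
apply/allP => x /row_wordP [i]; rewrite nth_tau mem_cat => /orP [].
  by case/(allP (E_le i))/andP.
by rewrite mem_filter => /andP [lt_mx _]; exact: leq_ltn_trans lt_mx.
Qed.

Lemma twin_tau : twin m w (row_word (tau m T)).
Proof.
split=> [|j k le_mj].
  rewrite upto_row_word (@eq_row_word _ E) => [|i].
    rewrite eE; apply: (knuth_trans (knuth_sym (knuth_rskP _))).
    exact: knuth_RC hv kv.
  rewrite nth_upto nth_tau upto_cat /upto (all_filterP (E_small i)).
  rewrite /above_m -filter_predI (eq_filter (a2 := pred0)) ?filter_pred0 ?cats0 //.
  by move=> x /=; lia.
rewrite [RHS]greene_upto greene_upto_row_word; last by case/andP: tau_tableau.
apply: eq_bigr => i _; rewrite -[rskP w]/T -[in RHS](sorted_split m (T_sorted i)).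
rewrite nth_tau !upto_cat !size_cat; congr (_ + _).
have all_le r : all (leq^~ m) r -> upto j r = r.
  move=> /allP hr; apply/all_filterP/allP => x /hr /= le_xm.
  exact: leq_trans le_mj.
by rewrite !all_le ?filter_all ?size_E.
Qed.
End Tau.

(** * The two inclusions *)

Lemma twin_centralizer m u w : word_le m u -> plactic_centralizer u w ->
  plactic_centralizer (RC m u) (row_word (tau m (rskP w))).
Proof.
move=> hu [hw hc]; have hw' := is_word_tau m hw; split=> //.
exact: twin_commute hu hw hw' (twin_tau m hw) hc.
Qed.

Lemma tau_rskP m w w' : is_word w -> twin m w w' -> tau m (rskP w) = rskP w'.
Proof.
move=> hw h; rewrite -(twin_unique (twin_tau m hw) h) rskP_row_word //.
exact: tau_tableau.
Qed.

Local Open Scope classical_set_scope.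

Theorem theorem4p7 (m : nat) (u : seq nat) (hm : 0 < m) (hu : word_le m u) :
  [set rskP w | w in plactic_centralizer (RC m u)] =
  [set tau m (rskP w) | w in plactic_centralizer u].
Proof.
apply/seteqP; split=> _ [w hc <-] /=; have [hw _] := hc; last first.
  exists (row_word (tau m (rskP w))); first exact: twin_centralizer.
  by rewrite rskP_row_word //; exact: tau_tableau.
(* This twin of [w] lies in the centralizer of [RC m (RC m u) = u]; by symmetry [w] is a twin of it,
   so [tau m] of its tableau is [rskP w]. *)
exists (row_word (tau m (rskP w))).
  by rewrite -(RC_K hu); apply: twin_centralizer => //; exact: RC_word_le.
apply: tau_rskP; first exact: is_word_tau.
by apply: twin_sym (twin_tau m hw) => //; exact: is_word_tau.
Qed.
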